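(* Let $\mu$ be a compactly supported positive Borel measure on $\mathbb{C}$. If $P^2(\mu)=L^2(\mu)$, then $\lambda(\mu,\mathbf{m}_{z_0;r})=0$ for every $z_0\in\mathbb{C}$ and every $r>0$.
   Context: $P^2(\mu)$ denotes the closure of the polynomials $\mathbb{P}[z]$ in $L^2(\mu)$. $\mathbf{m}_{z_0;r}$ is the normalized uniform Lebesgue (arc-length) probability measure on the circle $\{|z-z_0|=r\}$. For positive Borel measures $\mu_1,\mu_2$ on $\mathbb{C}$ with finite moments and $\mu_2$ infinitely supported, $\lambda(\mu_1,\mu_2)=\inf\{\int|p|^2d\mu_1/\int|p|^2d\mu_2 : p\in\mathbb{P}[z]\setminus\{0\}\}$ (equivalently, the limit of the smallest generalized eigenvalues of the $(n+1)\times(n+1)$ truncations of the moment matrix $\mathbf{M}(\mu_1)=(\int z^i\bar z^jd\mu_1)$ with respect to those of $\mathbf{M}(\mu_2)$). *)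

(* Defs.v *)
(* The complex plane C is modelled as R * R
   (R : realType) with the product of the Borel sigma-algebras (= Borel sets of
   R^2); complex numbers/polynomials use real_closed's R[i]. *)
From mathcomp Require Import all_boot all_order all_algebra.
From mathcomp Require Import all_classical all_reals all_analysis.
From mathcomp Require Export complex.

Set Implicit Arguments.
Unset Strict Implicit.
Unset Printing Implicit Defensive.

Import Order.TTheory GRing.Theory Num.Theory.
Local Open Scope classical_set_scope.
Local Open Scope ring_scope.

Section Defs.
Variable R : realType.

Definition toC (z : R * R) : R[i] := Complex z.1 z.2.

Definition sqmod (w : R[i]) : R := complex.Re w ^+ 2 + complex.Im w ^+ 2.

Definition L2int (mu : set (R * R) -> \bar R) (f : R * R -> R[i]) : \bar R :=
  (\int[mu]_z (sqmod (f z))%:E)%E.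

Definition polyfun (p : {poly R[i]}) : R * R -> R[i] := fun z => p.[toC z].

Definition inL2 (mu : set (R * R) -> \bar R) (f : R * R -> R[i]) : Prop :=
  [/\ measurable_fun setT (fun z => complex.Re (f z)),
      measurable_fun setT (fun z => complex.Im (f z)) &
      (L2int mu f < +oo)%E].

Definition P2_eq_L2 (mu : set (R * R) -> \bar R) : Prop :=
  forall f, inL2 mu f ->
  forall eps : R, 0 < eps ->
  exists p : {poly R[i]}, (L2int mu (fun z => (f z - polyfun p z)%R) < eps%:E)%E.

Definition lambda (mu1 mu2 : set (R * R) -> \bar R) : \bar R :=
  ereal_inf [set (L2int mu1 (polyfun p) * ((fine (L2int mu2 (polyfun p)))^-1)%:E)%E
            | p in [set p : {poly R[i]} | p != 0]].

Definition circle_pt (z0 : R * R) (r t : R) : R * R :=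
  (z0.1 + r * cos t, z0.2 + r * sin t).

(* m_{z0;r}: the normalized arc-length probability measure on the circle
   |z - z0| = r, i.e. the push-forward of (1/(2 pi)) * Lebesgue measure on
   [0, 2 pi[ under t |-> z0 + r e^{i t} *)
Definition unif_circle (z0 : R * R) (r : R) : set (R * R) -> \bar R :=
  fun A => (((2 * pi)^-1)%:E *
            (@lebesgue_measure R) (`[0%R, (2 * pi)%R[ `&` circle_pt z0 r @^-1` A))%E.

End Defs.

(* Main.v *)
(* Write w = z - z0.  Density lets a polynomial q approximate the bounded function
   conj w / (|w|^2 + e) in L^2(mu).  Then p = w (1 - w q) is small in L^2(mu):
   up to the approximation error, p is w e / (|w|^2 + e), whose square modulus is
   at most e; the extra factor w is what absorbs a possible atom of mu at z0.
   On the circle |w| = r, |p|^2 = r^2 |1 - w q|^2 >= r^2 (1 - 2 Re (w q)), and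
   w q has mean zero, so the integral of |p|^2 against m_{z0;r} is at least r^2. *)
Require Import Defs.
From mathcomp Require Import all_boot all_order all_algebra.
From mathcomp Require Import all_classical all_reals all_analysis.
From mathcomp Require Import complex measurable_realfun ring lra.

Import Order.TTheory GRing.Theory Num.Theory numFieldNormedType.Exports.
Local Open Scope classical_set_scope.
Local Open Scope ring_scope.

(** * Square moduli, measurability of polynomials, and the regularized inverse *)

Lemma sqmod_ge0 {R : realType} (w : R[i]) : 0 <= sqmod w.
Proof. by rewrite addr_ge0 ?sqr_ge0. Qed.

Lemma sqmodM {R : realType} (v w : R[i]) : sqmod (v * w) = sqmod v * sqmod w.
Proof. by case: v w => [a b] [c d]; rewrite /sqmod /=; ring. Qed.

Lemma sqmodD_le {R : realType} (v w : R[i]) :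
  sqmod (v + w) <= 2 * sqmod v + 2 * sqmod w.
Proof.
case: v w => [a b] [c d]; rewrite /sqmod /=.
have := sqr_ge0 (a - c); have := sqr_ge0 (b - d); nra.
Qed.

Lemma polyfun_subC {R : realType} (z0 z : R * R) :
  polyfun ('X - (toC z0)%:P) z = Complex (z.1 - z0.1) (z.2 - z0.2).
Proof. by rewrite /polyfun hornerXsubC. Qed.

Lemma measurable_polyfun {R : realType} (p : {poly R[i]}) :
  measurable_fun setT (fun z : R * R => complex.Re (polyfun p z)) /\
  measurable_fun setT (fun z : R * R => complex.Im (polyfun p z)).
Proof.
elim/poly_ind: p => [|p c [mRe mIm]].
  by split; (apply: (eq_measurable_fun (fun=> 0 : R)) => [z _|//]); rewrite /polyfun horner0.
split.
  apply: (eq_measurable_fun (fun z : R * R =>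
    complex.Re (polyfun p z) * z.1 - complex.Im (polyfun p z) * z.2 + complex.Re c)).
    by move=> z _; rewrite /polyfun !hornerE; case: (p.[toC z]) c => a b [].
  apply: measurable_funD => //; apply: measurable_funB; exact: measurable_funM.
apply: (eq_measurable_fun (fun z : R * R =>
  complex.Re (polyfun p z) * z.2 + complex.Im (polyfun p z) * z.1 + complex.Im c)).
  by move=> z _; rewrite /polyfun !hornerE; case: (p.[toC z]) c => a b [].
apply: measurable_funD => //; apply: measurable_funD; exact: measurable_funM.
Qed.

Lemma measurable_sqmod {d} {T : measurableType d} {R : realType} (f : T -> R[i]) :
  measurable_fun setT (fun z => complex.Re (f z)) ->
  measurable_fun setT (fun z => complex.Im (f z)) ->
  measurable_fun setT (fun z => sqmod (f z)).
Proof.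
by move=> mRe mIm; apply: measurable_funD; exact: measurable_funX.
Qed.

(* A bounded substitute for [w^-1], namely [conj w / (|w|^2 + e)]. *)
Definition reg_inv {R : realType} (e : R) (w : R[i]) : R[i] :=
  Complex (complex.Re w / (sqmod w + e)) (- complex.Im w / (sqmod w + e)).

(** With s = |w|^2 the left side is s / (s + e)^2, and e s <= (s + e)^2. Boundedness puts the
    regularized inverse in L^2 of any finite measure. *)
Lemma sqmod_reg_inv_le {R : realType} (e : R) (w : R[i]) :
  0 < e -> sqmod (reg_inv e w) <= e^-1.
Proof.
move=> e0; have s0 := sqmod_ge0 w.
have -> : sqmod (reg_inv e w) = sqmod w / (sqmod w + e) ^+ 2.
  have : sqmod w + e != 0 by lra.
  move: s0; case: w => a b; rewrite /reg_inv /sqmod /= => s0 n0.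
  by field.
rewrite ler_pdivrMr; last by nra.
by rewrite ler_pdivlMl //; nra.
Qed.

(** Here 1 - w [reg_inv e w] = e / (s + e) with s = |w|^2, and s e <= (s + e)^2. Without the outer
    factor w the defect would be 1 at w = 0 for every e. *)
Lemma sqmod_reg_inv_defect {R : realType} (e : R) (w : R[i]) :
  0 < e -> sqmod (w * (1 - w * reg_inv e w)) <= e.
Proof.
move=> e0; have s0 := sqmod_ge0 w.
have -> : sqmod (w * (1 - w * reg_inv e w)) =
    sqmod w * (e / (sqmod w + e)) ^+ 2.
  have : sqmod w + e != 0 by lra.
  move: s0; case: w => a b; rewrite /reg_inv /sqmod /= => s0 n0.
  by field.
rewrite expr_div_n mulrA ler_pdivrMr; nra.
Qed.

(** * Topology of the plane: measurability and bounds *)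

(** The sigma-algebra is the product one, so an open set is written as a countable union of rational
    open boxes. *)
Lemma open_measurable_prod {R : realType} (U : set (R * R)) :
  open U -> measurable U.
Proof.
move=> oU.
pose box (a : rat * rat * rat * rat) : set (R * R) :=
  `]ratr a.1.1.1, ratr a.1.1.2[%classic `*` `]ratr a.1.2, ratr a.2[%classic.
(* Indexing by all rational quadruples keeps the union countable; boxes not inside [U] are replaced
   by [set0]. *)
rewrite (_ : U = \bigcup_a (if `[< box a `<=` U >] then box a else set0)).
  apply: countable_bigcupT_measurable => [|a]; first exact: countableP.
  by case: ifP => // _; apply: measurableX; exact: measurable_itv.
apply/seteqP; split => [x Ux|x [a _]]; last by case: asboolP => // + ?; apply.
have /nbhs_ballP[e /= e0 xeU] : nbhs x U by exact: open_nbhs_nbhs.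
have lt1 (y : R) : y - e < y by rewrite ltrBlDr ltrDl.
have lt2 (y : R) : y < y + e by rewrite ltrDl.
have [a] := rat_in_itvoo (lt1 x.1); have [b] := rat_in_itvoo (lt2 x.1).
have [c] := rat_in_itvoo (lt1 x.2); have [d] := rat_in_itvoo (lt2 x.2).
rewrite !in_itv /= => /andP[d1 d2] /andP[c1 c2] /andP[b1 b2] /andP[a1 a2].
exists (a, b, c, d) => //; case: asboolP => [_|[]].
  by split; rewrite /= in_itv /= ?a2 ?b1 ?c2 ?d1.
move=> y [] /=; rewrite !in_itv /= => /andP[y1 y2] /andP[y3 y4].
by apply: xeU; split; rewrite /ball /= ltr_distlC; apply/andP; split; lra.
Qed.

Lemma compact_measurable_prod {R : realType} (K : set (R * R)) :
  compact K -> measurable K.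
Proof.
move=> cK; rewrite -(setCK K).
have oK : open (~` K).
  by apply: closed_openC; apply: (compact_closed (@norm_hausdorff _ (R * R)%type) cK).
exact: (measurableC (open_measurable_prod _ oK)).
Qed.

(** The bound is on |z - z0|^4 because the approximation error enters later multiplied by (z -
    z0)^2. *)
Lemma compact_sqmod_bounded {R : realType} (K : set (R * R)) (z0 : R * R) :
  compact K ->
  exists2 M : R, 0 < M &
    forall z, K z -> sqmod (polyfun ('X - (toC z0)%:P) z) ^+ 2 <= M.
Proof.
move=> /compact_bounded[B [_ KB]].
have {KB} KB z : K z -> `|z| <= `|B| + 1.
  by apply: KB; rewrite (le_lt_trans (ler_norm _))// ltrDl.
(* The norm on the product is the max norm, so [C] bounds both coordinates of z - z0 on [K]. *)
pose C := `|B| + 1 + `|z0.1| + `|z0.2|.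
have C0 : 0 < C by rewrite /C -!addrA ltr_wpDl// ltr_pwDl// addr_ge0.
exists ((C ^+ 2 + C ^+ 2) ^+ 2); first by rewrite exprn_gt0// addr_gt0 ?exprn_gt0.
move=> z /KB zB.
have z1 : `|z.1| <= `|z| by rewrite [leRHS]prod_normE le_max lexx.
have z2 : `|z.2| <= `|z| by rewrite [leRHS]prod_normE le_max lexx orbT.
rewrite polyfun_subC /sqmod /= lerXn2r ?nnegrE ?addr_ge0 ?sqr_ge0//.
rewrite lerD// -[leLHS]real_normK ?num_real// lerXn2r ?nnegrE ?(ltW C0)//.
  by rewrite (le_trans (ler_normB _ _))// /C; have := normr_ge0 z0.2; lra.
by rewrite (le_trans (ler_normB _ _))// /C; have := normr_ge0 z0.1; lra.
Qed.

(** * Polynomials of small norm in L^2(mu) *)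

Lemma inL2_bounded {R : realType} (mu : {measure set (R * R) -> \bar R})
    (f : R * R -> R[i]) (C : R) :
  (mu setT < +oo)%E ->
  measurable_fun setT (fun z => complex.Re (f z)) ->
  measurable_fun setT (fun z => complex.Im (f z)) ->
  (forall z, sqmod (f z) <= C) -> inL2 mu f.
Proof.
move=> fin mRe mIm fC; split => //.
apply: (@le_lt_trans _ _ (\int[mu]_(z in setT) (cst C%:E) z)%E).
  apply: ge0_le_integral => //.
  - by move=> z _; rewrite lee_fin sqmod_ge0.
  - by apply/measurable_EFinP; exact: measurable_sqmod.
  - by move=> z _; rewrite lee_fin fC.
rewrite (integral_cst mu measurableT) -(@fineK _ (mu setT)) ?ge0_fin_numE//.
by rewrite -EFinM ltry.
Qed.

Lemma small_parameters {R : realFieldType} (eta m M : R) :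
  0 < eta -> 0 <= m -> 0 < M ->
  exists e delta : R, [/\ 0 < e, 0 < delta & 2 * e * m + 2 * M * delta <= eta].
Proof.
(* Each summand is at most eta / 2; [m + 1] avoids dividing by zero when the total mass [m]
   vanishes. *)
move=> eta0 m0 M0; exists (eta / (4 * (m + 1))), (eta / (4 * M)).
split; [by rewrite divr_gt0//; lra|by rewrite divr_gt0//; lra|].
have -> : 2 * M * (eta / (4 * M)) = eta / 2 by field; lra.
have -> : 2 * (eta / (4 * (m + 1))) * m = eta / 2 * (m / (m + 1)).
  by field; lra.
have : m / (m + 1) <= 1 by rewrite ler_pdivrMr; lra.
nra.
Qed.

Lemma vanishing_poly_approx {R : realType} {mu : {measure set (R * R) -> \bar R}} :
  (mu setT < +oo)%E ->
  (exists K : set (R * R), compact K /\ mu (~` K) = 0%E) ->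
  P2_eq_L2 mu ->
  forall (z0 : R * R) (eta : R), 0 < eta ->
  exists q : {poly R[i]},
    (L2int mu (polyfun (('X - (toC z0)%:P) * (1 - ('X - (toC z0)%:P) * q)))
      < eta%:E)%E.
Proof.
move=> fin [K [cK muK]] dens z0 eta eta0.
have [M M0 KM] := compact_sqmod_bounded _ z0 cK.
pose m := fine (mu setT).
have muE : mu setT = m%:E by rewrite fineK ?ge0_fin_numE.
have m0 : 0 <= m by rewrite fine_ge0.
have [e [delta [e0 delta0 bound]]] := small_parameters _ _ _ eta0 m0 M0.
have e2 : 0 <= 2 * e by lra.
have M2 : 0 <= 2 * M by lra.
pose P : {poly R[i]} := 'X - (toC z0)%:P.
pose f z := reg_inv e (polyfun P z).
have [mRe mIm] := measurable_polyfun P.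
(* The denominator is positive, so its inverse is the real power -1, whose measurability is
   known. *)
have mden : measurable_fun setT (fun z => (sqmod (polyfun P z) + e)^-1).
  have dE z : (sqmod (polyfun P z) + e)^-1 = (sqmod (polyfun P z) + e) `^ (-1).
    by rewrite powR_inv1// addr_ge0 ?sqmod_ge0// ltW.
  apply: (eq_measurable_fun (fun z => (sqmod (polyfun P z) + e) `^ (-1))).
    by move=> z _; rewrite dE.
  apply: (measurableT_comp (measurable_powR (-1))).
  by apply: measurable_funD => //; exact: measurable_sqmod.
have mfRe : measurable_fun setT (fun z => complex.Re (f z)).
  exact: measurable_funM.
have mfIm : measurable_fun setT (fun z => complex.Im (f z)).
  by apply: measurable_funM => //; exact: measurableT_comp.
have [q qd] : exists q, (L2int mu (fun z => (f z - polyfun q z)%R) < delta%:E)%E.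
  apply: dens => //; apply: (inL2_bounded _ _ e^-1) => // z.
  exact: sqmod_reg_inv_le.
exists q; rewrite -/P.
pose g z := f z - polyfun q z.
have mg : measurable_fun setT (fun z => sqmod (g z)).
  have [mqRe mqIm] := measurable_polyfun q.
  apply: measurable_sqmod.
    apply: (eq_measurable_fun (fun z => complex.Re (f z) - complex.Re (polyfun q z))).
      by move=> z _; rewrite /g; case: (f z) (polyfun q z) => ? ? [].
    exact: measurable_funB.
  apply: (eq_measurable_fun (fun z => complex.Im (f z) - complex.Im (polyfun q z))).
    by move=> z _; rewrite /g; case: (f z) (polyfun q z) => ? ? [].
  exact: measurable_funB.
set p := P * _.
(* Substituting q = f - g in P (1 - P q) separates the regularization defect from the approximation
   error. *)
have pE z : polyfun p z =
    polyfun P z * (1 - polyfun P z * f z) + polyfun P z ^+ 2 * g z.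
  by rewrite /polyfun /p /g /polyfun !hornerE /=; ring.
have p_le z : K z -> sqmod (polyfun p z) <= 2 * e + 2 * M * sqmod (g z).
  move=> /KM; rewrite -/P => zM; rewrite pE (le_trans (sqmodD_le _ _))// lerD//.
    by rewrite ler_pM2l// sqmod_reg_inv_defect.
  by rewrite -mulrA ler_pM2l// !sqmodM -expr2 ler_wpM2r// sqmod_ge0.
have g_ge0 z : (0 <= (sqmod (g z))%:E)%E by rewrite lee_fin sqmod_ge0.
have mgE : measurable_fun setT (fun z => (sqmod (g z))%:E).
  exact/measurable_EFinP.
apply: (@le_lt_trans _ _
  (\int[mu]_z ((2 * e)%:E + (2 * M)%:E * (sqmod (g z))%:E))%E).
  (* The pointwise bound holds only on [K], whose complement is a measurable null set. *)
  apply: ae_ge0_le_integral => //.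
  - by move=> z _; rewrite lee_fin sqmod_ge0.
  - have [? ?] := measurable_polyfun p.
    by apply/measurable_EFinP; exact: measurable_sqmod.
  - by move=> z _; rewrite -EFinM -EFinD lee_fin addr_ge0// mulr_ge0// sqmod_ge0.
  - apply: emeasurable_funD => //.
    by apply: measurable_funeM.
  - exists (~` K); split => //; first exact: (measurableC (compact_measurable_prod _ cK)).
    move=> z /= nz Kz; apply: nz => _.
    by rewrite -EFinM -EFinD lee_fin p_le.
rewrite ge0_integralD//=; last 2 first.
- by move=> z _; rewrite mule_ge0// lee_fin.
- exact: measurable_funeM.
rewrite (integral_cst mu measurableT) ge0_integralZl//.
rewrite muE -EFinM.
(* Strictness comes from [qd], the parameters giving only a large inequality. *)
apply: (@lt_le_trans _ _ ((2 * e * m)%:E + (2 * M)%:E * delta%:E)%E).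
  by rewrite lteD2lE// lte_pmul2l// lte_fin mulr_gt0.
by rewrite -EFinM -EFinD lee_fin.
Qed.

(** * Polynomials along a circle *)

Lemma exists_primitive_poly {F : numFieldType} (s : {poly F}) :
  exists Q : {poly F}, Q^`() = s.
Proof.
(* At i = 0 the coefficient is a division by zero, hence 0; the derivative discards it anyway. *)
exists (\poly_(i < (size s).+1) (s`_i.-1 / i%:R)).
apply/polyP => i; rewrite coef_deriv coef_poly ltnS /=.
case: ltnP => [_|/(nth_default 0) ->]; last by rewrite mul0rn.
by rewrite -[LHS]mulr_natr mulfVK// pnatr_eq0.
Qed.

Definition circ {R : realType} (r t : R) : R[i] :=
  Complex (r * cos t) (r * sin t).

Lemma polyfun_sub_circle {R : realType} (z0 : R * R) (r t : R) :
  polyfun ('X - (toC z0)%:P) (circle_pt z0 r t) = circ r t.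
Proof.
by rewrite polyfun_subC /circ /circle_pt /= ![_ + _ - _]addrAC !subrr !add0r.
Qed.

(* The real and imaginary parts of [d/dt Q(r e^{it}) = i w Q'(w)]. *)
Lemma is_derive_circ {R : realType} (Q : {poly R[i]}) (r t : R) :
  is_derive t 1 (fun x => complex.Re Q.[circ r x])
    (- complex.Im (circ r t * Q^`().[circ r t])) /\
  is_derive t 1 (fun x => complex.Im Q.[circ r x])
    (complex.Re (circ r t * Q^`().[circ r t])).
Proof.
have dcos : is_derive t 1 (fun x : R => r * cos x) (- (r * sin t)).
  by apply: is_derive_eq; rewrite /GRing.scale /=; ring.
have dsin : is_derive t 1 (fun x : R => r * sin x) (r * cos t).
  by apply: is_derive_eq; rewrite /GRing.scale /=; ring.
elim/poly_ind: Q => [|P c [dRe dIm]].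
  rewrite deriv0 horner0 mulr0 /= oppr0.
  by split; under eq_fun do rewrite horner0 /=; exact: is_derive_cst.
split.
  (* The Horner form P X + c is split into real and imaginary parts so that the real product rule
     applies. *)
  rewrite (_ : (fun x => _) = (fun x => complex.Re P.[circ r x]) * (fun x => r * cos x)
     - (fun x => complex.Im P.[circ r x]) * (fun x => r * sin x) + cst (complex.Re c)); last first.
    apply/funext => x; rewrite !hornerE /= !fctE; case: (P.[_]) c => a b [c1 c2] /=; ring.
  apply: is_derive_eq.
  rewrite derivD derivM derivX derivC !hornerE /GRing.scale /=.
  by case: P.[circ r t] P^`().[circ r t] => a b [a' b'] /=; ring.
rewrite (_ : (fun x => _) = (fun x => complex.Re P.[circ r x]) * (fun x => r * sin x)
   + (fun x => complex.Im P.[circ r x]) * (fun x => r * cos x) + cst (complex.Im c)); last first.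
  by apply/funext => x; rewrite !hornerE /= !fctE; case: (P.[_]) c => a b [c1 c2] /=; ring.
apply: is_derive_eq.
rewrite derivD derivM derivX derivC !hornerE /GRing.scale /=.
by case: P.[circ r t] P^`().[circ r t] => a b [a' b'] /=; ring.
Qed.

Lemma continuous_circ {R : realType} (Q : {poly R[i]}) (r : R) :
  continuous (fun x : R => complex.Re Q.[circ r x]) /\
  continuous (fun x : R => complex.Im Q.[circ r x]).
Proof.
by split=> t; have [[dRe _] [dIm _]] := is_derive_circ Q r t;
  apply: differentiable_continuous; exact/derivable1_diffP.
Qed.

(** * Integration against the circle measure *)

(** [unif_circle] is a bare set function; identifying it with a scaled push-forward of restricted
    Lebesgue measure gives access to change of variables. *)
Lemma ge0_integral_unif_circle {R : realType} (z0 : R * R) (r : R)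
    (f : R * R -> \bar R) :
  measurable_fun setT f -> (forall z, 0 <= f z)%E ->
  (\int[unif_circle z0 r]_z f z = (2 * pi)^-1%:E *
     \int[lebesgue_measure]_(t in `[0%R, (2 * pi)%R[) f (circle_pt z0 r t))%E.
Proof.
move=> mf f0.
have mcirc : measurable_fun setT (circle_pt z0 r).
  apply/measurable_fun_pairP; split.
    apply: measurable_funD => //; apply: measurable_funM => //.
    by apply: continuous_measurable_fun; exact: continuous_cos.
  apply: measurable_funD => //; apply: measurable_funM => //.
  by apply: continuous_measurable_fun; exact: continuous_sin.
have k0 : 0 <= (2 * pi)^-1 :> R by rewrite invr_ge0 mulr_ge0// pi_ge0.
have mI : measurable (`[0%R, (2 * pi)%R[%classic : set R) by exact: measurable_itv.
pose leb := mrestr (@lebesgue_measure R) mI.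
rewrite (_ : unif_circle z0 r =
    mscale (NngNum k0) (pushforward leb (circle_pt z0 r))); last first.
  by apply/funext => A; rewrite /unif_circle /mscale /pushforward /leb /mrestr setIC.
rewrite ge0_integral_mscale//=.
congr (_ * _)%E.
rewrite ge0_integral_pushforward// preimage_setT.
(* The restricted measure vanishes off the interval and agrees with Lebesgue measure on its
   measurable subsets. *)
rewrite -(setUv `[0%R, (2 * pi)%R[).
have mfc : measurable_fun setT (f \o circle_pt z0 r) by exact: measurableT_comp.
rewrite ge0_integral_setU//=; last 3 first.
- exact: (measurableC mI).
- by rewrite setUv.
- exact/disj_setPCl.
rewrite [X in (_ + X)%E](_ : _ = 0%E); last first.
  apply: null_set_integral => //; first exact: (measurableC mI).
    exact: measurable_funTS.
  by rewrite /= /mrestr setICl measure0.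
rewrite adde0; apply: eq_measure_integral => A mA AI.
by rewrite /= /mrestr setIidl.
Qed.

Lemma L2int_unif_circle_ge {R : realType} (z0 : R * R) (r : R) (q : {poly R[i]}) :
  ((r ^+ 2)%:E <=
  L2int (unif_circle z0 r)
    (polyfun (('X - (toC z0)%:P) * (1 - ('X - (toC z0)%:P) * q))))%E.
Proof.
set P := 'X - _; set p := P * _.
(* Recentring at z0 gives q(z) = Q'(w) with w = z - z0, so Re (w q) is the derivative in t of Im Q(r
   e^{it}). *)
have [Q QE] := exists_primitive_poly (q \Po ('X + (toC z0)%:P)).
pose u t := complex.Re (circ r t * Q^`().[circ r t]).
have qE z : polyfun q z = Q^`().[polyfun P z].
  by rewrite QE /polyfun horner_comp !hornerE subrK.
(* This drops |a|^2 from |1 - a|^2 = 1 - 2 Re a + |a|^2, where a = w q. *)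
have p_ge t : r ^+ 2 * (1 - 2 * u t) <= sqmod (polyfun p (circle_pt z0 r t)).
  have -> : polyfun p (circle_pt z0 r t) =
      circ r t * (1 - circ r t * Q^`().[circ r t]).
    by rewrite -(polyfun_sub_circle z0) -qE /polyfun /p !hornerE.
  rewrite sqmodM; have -> : sqmod (circ r t) = r ^+ 2.
    by rewrite /sqmod /= !exprMn -mulrDr cos2Dsin2 mulr1.
  rewrite ler_wpM2l ?sqr_ge0// /u; case: (circ r t * _) => a b; rewrite /sqmod /=.
  by have := sqr_ge0 a; have := sqr_ge0 b; nra.
have pi0 : 0 < 2 * pi :> R by rewrite mulr_gt0// pi_gt0.
have cu : continuous u.
  have [cRe _] := continuous_circ ('X * Q^`()) r.
  rewrite (_ : u = fun t => complex.Re ('X * Q^`()).[circ r t])//.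
  by apply/funext => t; rewrite hornerM hornerX.
have cp : continuous (fun t => sqmod (polyfun p (circle_pt z0 r t))).
  pose p' := p \Po ('X + (toC z0)%:P).
  have [cRe cIm] := continuous_circ p' r.
  rewrite (_ : (fun t => _) = (fun t =>
      complex.Re p'.[circ r t] * complex.Re p'.[circ r t] +
      complex.Im p'.[circ r t] * complex.Im p'.[circ r t])).
    by move=> t; apply: cvgD; apply: cvgM; (exact: cRe || exact: cIm).
  apply/funext => t; rewrite /sqmod /polyfun /p' horner_comp !hornerE.
  by rewrite -(polyfun_sub_circle z0) /polyfun !hornerE subrK.
pose f t := r ^+ 2 * (1 - 2 * u t).
have cf : continuous f.
  move=> t; apply: cvgM; first exact: cvg_cst.
  apply: cvgB; first exact: cvg_cst.
  by apply: cvgM; [exact: cvg_cst|exact: cu].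
(* [F] is a primitive of [f]; over a full turn the [Q] term cancels by periodicity, leaving r^2 (2
   pi). *)
pose F x := r ^+ 2 * (x - 2 * complex.Im Q.[circ r x]).
have dF (t : R) : is_derive t 1 F (f t).
  have [_ ?] := is_derive_circ Q r t.
  rewrite (_ : F =
    cst (r ^+ 2) * (id - cst 2 * (fun x => complex.Im Q.[circ r x]))) //.
  by apply: is_derive_eq; rewrite /f /u /GRing.scale /=; ring.
have intf : (\int[lebesgue_measure]_(t in `[0%R, (2 * pi)%R]) (f t)%:E
             = (r ^+ 2 * (2 * pi))%:E)%E.
  rewrite (continuous_FTC2 (F := F) pi0 (continuous_subspaceT cf)).
  - rewrite -EFinB; congr EFin; rewrite /F.
    have -> : circ r (2 * pi) = circ r 0.
      by rewrite /circ mulr_natl cos2pi sin2pi cos0 sin0.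
    by ring.
  - have cF : continuous F.
      move=> t; apply: differentiable_continuous.
      by apply/derivable1_diffP; exact: ex_derive.
    split.
    + by move=> t _; exact: ex_derive.
    + by apply: cvg_at_right_filter; exact: cF.
    + by apply: cvg_at_left_filter; exact: cF.
  - by move=> t _; rewrite derive1E derive_val.
have [mRe mIm] := measurable_polyfun p.
have mp := measurable_sqmod _ mRe mIm.
rewrite /L2int ge0_integral_unif_circle; last 2 first.
- exact/measurable_EFinP.
- by move=> z; rewrite lee_fin sqmod_ge0.
(* Closing the interval changes no integral and makes it compact, so continuous functions are
   integrable on it. *)
rewrite integral_itv_bndo_bndc; last first.
  apply/measurable_EFinP/measurable_funTS; exact: continuous_measurable_fun.
rewrite lee_pdivlMl// -EFinM mulrC -intf.
have integrable_cont (h : R -> R) : continuous h ->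
    lebesgue_measure.-integrable `[0, 2 * pi] (EFin \o h).
  move=> ch; apply: continuous_compact_integrable; first exact: segment_compact.
  exact: continuous_subspaceT.
apply: le_integral.
- exact: measurable_itv.
- exact: integrable_cont cf.
- exact: integrable_cont cp.
by move=> t _; rewrite lee_fin; exact: p_ge.
Qed.

(** * The value of the infimum *)

Lemma lambda_unif_circle_ge0 {R : realType}
    (mu : {measure set (R * R) -> \bar R}) (z0 : R * R) (r : R) :
  (0 <= lambda mu (unif_circle z0 r))%E.
Proof.
apply: le_ereal_inf_tmp => _ [p _ <-].
have sq_ge0 z : (0 <= (sqmod (polyfun p z))%:E)%E by rewrite lee_fin sqmod_ge0.
apply: mule_ge0; first exact: integral_ge0.
rewrite lee_fin invr_ge0 fine_ge0// /L2int.
have [mRe mIm] := measurable_polyfun p.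
rewrite ge0_integral_unif_circle//.
  by rewrite mule_ge0 ?integral_ge0// lee_fin invr_ge0 mulr_ge0// pi_ge0.
exact/measurable_EFinP/measurable_sqmod.
Qed.

Theorem theorem3 (R : realType) (mu : {measure set (R * R) -> \bar R}) :
  (mu setT < +oo)%E ->
  (exists K : set (R * R), compact K /\ mu (~` K) = 0%E) ->
  P2_eq_L2 mu ->
  forall (z0 : R * R) (r : R), 0 < r -> lambda mu (unif_circle z0 r) = 0%E.
Proof.
move=> fin supp dens z0 r r0; apply/eqP; rewrite eq_le lambda_unif_circle_ge0 andbT.
apply/lee_addgt0Pr => eta eta0; rewrite add0e.
have r20 : 0 < r ^+ 2 by rewrite exprn_gt0.
(* The tolerance eta r^2 compensates the division by a circle integral that is at least r^2. *)
have [q] := vanishing_poly_approx fin supp dens z0 _ (mulr_gt0 eta0 r20).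
have := L2int_unif_circle_ge z0 r q.
set p := _ * _; set m := unif_circle z0 r => m_ge mu_lt.
have p0 : p != 0.
  rewrite mulf_neq0 ?polyXsubC_eq0//.
  (* The second factor takes the value 1 at z0, so it is not the zero polynomial. *)
  apply: contraTneq (oner_neq0 R[i]) => /(congr1 (horner^~ (toC z0))).
  by rewrite !hornerE subrr mul0r subr0 => ->; rewrite eqxx.
apply: ge_ereal_inf.
exists (L2int mu (polyfun p) * ((fine (L2int m (polyfun p)))^-1)%:E)%E.
  by exists p.
(* An infinite integral has [fine] equal to 0, and the quotient is then 0. *)
case: (L2int m (polyfun p)) m_ge => [s| |] //=; last first.
  by move=> _; rewrite invr0 mule0 lee_fin ltW.
rewrite lee_fin => rs; have s0 := lt_le_trans r20 rs.
rewrite lee_pdivrMr// -EFinM (le_trans (ltW mu_lt))// lee_fin.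
by rewrite ler_wpM2l// ltW.
Qed.
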